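(* Let $G_2$ be a finite nilpotent group which acts trivially on an abelian torsion group $G_1$, and let $\varepsilon_1,\varepsilon_2\in Z^2(G_2,G_1)$. Let $\pi(G_2)=\{p_1,\dots,p_k\}$ be the set of prime divisors of $|G_2|$ and, for each $1\le i\le k$, let $G_{2i}$ be the Sylow $p_i$-subgroup of $G_2$, let $G_{1p_i}$ be the $p_i$-component of $G_1$, and let $\varepsilon_{1i},\varepsilon_{2i}\in Z^2(G_{2i},G_{1p_i})$ be the cocycles induced by $\varepsilon_1,\varepsilon_2$ respectively. Suppose that $G_{1p_i}\underset{\varepsilon_{1i}}{\times}G_{2i}$ and $G_{1p_i}\underset{\varepsilon_{2i}}{\times}G_{2i}$ are upper isomorphic for all $1\le i\le k$. Then $G_1\underset{\varepsilon_1}{\times}G_2$ and $G_1\underset{\varepsilon_2}{\times}G_2$ are upper isomorphic.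
   Context: Groups are written multiplicatively. For a group $Q$ acting trivially on an abelian group $A$, $Z^2(Q,A)$ is the group of normalized 2-cocycles, i.e. maps $\varepsilon:Q\times Q\to A$ with $\varepsilon(g,1)=\varepsilon(1,g)=1$ and $\varepsilon(h,g)\varepsilon(hg,k)=\varepsilon(g,k)\varepsilon(h,gk)$ for all $g,h,k\in Q$. The perturbed direct product $A\underset{\varepsilon}{\times}Q$ is the group with underlying set $A\times Q$ and operation $(x,y)(x',y')=(xx'\varepsilon(y,y'),yy')$. The groups $A\underset{\varepsilon}{\times}Q$ and $A\underset{\varepsilon'}{\times}Q$ are called upper isomorphic if there is a group isomorphism $\varphi$ from the first to the second leaving $A$ invariant, i.e. $\varphi(A\times\{1\})=A\times\{1\}$. An abelian torsion group $G_1$ is the restricted direct product of its $p$-components $G_{1p}$ (the subgroup of elements of $p$-power order). For $j\in\{1,2\}$, $\varepsilon_{ji}$ denotes the restriction of $\varepsilon_j$ to $G_{2i}\times G_{2i}$ followed by the projection $G_1\to G_{1p_i}$. *)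

(* Defs.v *)
From HB Require Import structures.
From mathcomp Require Import all_boot all_fingroup all_algebra all_solvable.
From mathcomp Require Import boolp classical_sets.

Set Implicit Arguments.
Unset Strict Implicit.
Unset Printing Implicit Defensive.

Import GRing.Theory.
Local Open Scope group_scope.
Local Open Scope ring_scope.

(* Abelian coefficient groups are zmodTypes, hence written additively;       *)
(* all other groups are multiplicative groupTypes. Actions are trivial, so   *)
(* they do not appear in the cocycle identity or in the group law below.     *)

Record Z2 (Q : groupType) (A : zmodType) := Cocycle {
  cocycle_fun :> Q -> Q -> A;
  cocycle_g1 : forall g, cocycle_fun g 1%g = 0;
  cocycle_1g : forall g, cocycle_fun 1%g g = 0;
  cocycleP : forall h g k,
    cocycle_fun h g + cocycle_fun (h * g)%g k
      = cocycle_fun g k + cocycle_fun h (g * k)%g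
}.

Definition perturbed_prod (Q : groupType) (A : zmodType) (eps : Z2 Q A) : Type :=
  (A * Q)%type.

Section PerturbedProduct.
Variables (Q : groupType) (A : zmodType) (eps : Z2 Q A).
Local Notation E := (perturbed_prod eps).

Definition pp_mul (u v : E) : E :=
  (u.1 + v.1 + eps u.2 v.2, (u.2 * v.2)%g).

Definition pp_one : E := (0, 1%g).

Definition pp_inv (u : E) : E :=
  (- u.1 - eps u.2^-1%g u.2, u.2^-1%g).

Fact pp_mulA : associative pp_mul.
Proof.
move=> [a x] [b y] [c z]; rewrite /pp_mul /=; congr pair; last exact: mulgA.
rewrite !addrA -!(addrAC _ c) -!addrA; congr (_ + (_ + (_ + _))).
by rewrite cocycleP.
Qed.

Fact pp_mul1 : left_id pp_one pp_mul.
Proof. by case=> a x; rewrite /pp_mul /= cocycle_1g add0r addr0 mul1g. Qed.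

Fact pp_mulr1 : right_id pp_one pp_mul.
Proof. by case=> a x; rewrite /pp_mul /= cocycle_g1 !addr0 mulg1. Qed.

Fact pp_mulV : left_inverse pp_one pp_inv pp_mul.
Proof.
case=> a x; rewrite /pp_mul /pp_inv /= mulVg; congr pair.
by rewrite addrAC -(addrA (- a)) addNr addr0 addNr.
Qed.

Fact pp_mulrV : right_inverse pp_one pp_inv pp_mul.
Proof.
case=> a x; rewrite /pp_mul /pp_inv /= mulgV; congr pair.
have := cocycleP eps x x^-1%g x.
rewrite mulgV mulVg cocycle_1g cocycle_g1 !addr0 => ->.
by rewrite addrA subrr add0r addNr.
Qed.

HB.instance Definition _ := Choice.copy E (A * Q)%type.
HB.instance Definition _ :=
  isGroup.Build E pp_mulA pp_mul1 pp_mulr1 pp_mulV pp_mulrV.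

Definition pp_base : set E := ([set: A] `*` [set 1%g : Q])%classic.

End PerturbedProduct.

Arguments pp_base {Q A} eps _.

Definition upper_isomorphic (Q : groupType) (A : zmodType) (eps eps' : Z2 Q A) :=
  exists phi : {multiplicative perturbed_prod eps -> perturbed_prod eps'},
    bijective phi /\ (phi @` pp_base eps = pp_base eps')%classic.

Definition torsion (A : zmodType) :=
  forall x : A, exists2 n, (0 < n)%N & x *+ n = 0.

(* For p prime, the elements whose order is a power of p. *)
Definition pcomp_pred (A : zmodType) (p : nat) : {pred A} :=
  fun x => `[< exists n, x *+ (p ^ n) = 0 >].

Arguments pcomp_pred A p _ : clear implicits.

Fact pcomp_zmod_closed (A : zmodType) (p : nat) : zmod_closed (pcomp_pred A p).
Proof.
split=> [|x y]; first by apply/asboolP; exists 0%N; rewrite mul0rn.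
move=> /asboolP[m mx] /asboolP[n ny]; apply/asboolP; exists (m + n)%N.
by rewrite expnD mulrnBl mulrnA mx mul0rn mulnC mulrnA ny mul0rn subrr.
Qed.

HB.instance Definition _ (A : zmodType) (p : nat) :=
  GRing.isZmodClosed.Build A (pcomp_pred A p) (pcomp_zmod_closed A p).

Definition pcomponent (A : zmodType) (p : nat) := {x : A | x \in pcomp_pred A p}.

HB.instance Definition _ (A : zmodType) (p : nat) :=
  SubChoice.on (pcomponent A p).
HB.instance Definition _ (A : zmodType) (p : nat) :=
  [SubChoice_isSubZmodule of pcomponent A p by <:].

(* (f p)_p are the coordinates of x in the restricted direct product of the  *)
(* p-components: finitely supported, and trivial at every non-prime index.   *)
Definition primary_decomposition (A : zmodType) (x : A)
    (f : forall p, pcomponent A p) :=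
  exists s : seq nat, [/\ uniq s, all prime s,
    forall p, p \notin s -> f p = 0 & x = \sum_(p <- s) val (f p)].

Section PrimaryProjection.
Variables (A : zmodType) (torA : torsion A).

Fact primary_decomposition_exists (x : A) :
  exists f, primary_decomposition x f.
Proof.
have [n n0 xn] := torA x.
suff H s : uniq s -> all prime s -> forall (m : nat) (y : A), (0 < m)%N ->
    (forall q, q \in primes m -> q \in s) -> y *+ m = 0 ->
    exists f : forall p, pcomponent A p,
      (forall p, p \notin s -> f p = 0) /\ y = \sum_(p <- s) val (f p).
  have pn : all prime (primes n).
    by apply/allP => q; rewrite mem_primes => /andP[].
  have [//|f [f0 fx]] := H _ (primes_uniq n) pn n x n0 _ xn.
  by exists f, (primes n); split=> //; exact: primes_uniq.
elim: s => [_ _ m y m0 ms ym|p s IHs /=].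
  exists (fun=> 0); split=> //; rewrite big_nil.
  have [m1|m1] := leqP m 1; first by have <- : y *+ 1 = 0; rewrite // -ym; congr (_ *+ _); apply/eqP; rewrite eqn_leq m0 m1.
  have := ms (pdiv m); rewrite mem_primes pdiv_prime // pdiv_dvd m0 => /(_ isT).
  by rewrite in_nil.
move=> /andP[ps us] /andP[pp sp] m y m0 ms ym.
have mE : (m`_p * m`_p^')%N = m by exact: partnC.
have cop : coprime m`_p m`_p^' by exact: coprime_partC.
have mp0 : (0 < m`_p)%N by exact: part_gt0.
case: (egcdnP m`_p^' mp0) => u v uv _; move: uv; rewrite (eqP cop) => uv.
have uE : y *+ (u * m`_p) = y *+ (v * m`_p^') + y by rewrite uv mulrnDr mulr1n.
have zp : - (y *+ (v * m`_p^')) \in pcomp_pred A p.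
  rewrite rpredN; apply/asboolP; exists (logn p m).
  rewrite -mulrnA -p_part -mulnA (mulnC _ (m`_p)%N) mE mulnC mulrnA ym.
  by rewrite mul0rn.
have [|q||f [f0 fy]] := IHs us sp (m`_p^')%N (y *+ (u * m`_p)).
- exact: part_gt0.
- rewrite primes_part mem_filter => /andP[qp /ms].
  by rewrite in_cons => /orP[/eqP qE|//]; rewrite qE !inE eqxx in qp.
- by rewrite -mulrnA -mulnA mE mulnC mulrnA ym mul0rn.
pose z : pcomponent A p := exist (fun x => x \in pcomp_pred A p) _ zp.
pose g q : pcomponent A q :=
  match @eqP _ p q with
  | ReflectT e => ecast q (pcomponent A q) e z
  | ReflectF _ => f q
  end.
have gp : g p = z.
  by rewrite /g; case: eqP => // e; rewrite (eq_irrelevance e (erefl p)).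
have gf q : q != p -> g q = f q.
  by rewrite /g => qp; case: eqP => // e; rewrite e eqxx in qp.
exists g; split=> [q|].
  by rewrite in_cons negb_or => /andP[qp qs]; rewrite gf // f0.
rewrite big_cons gp /=.
have -> : \sum_(q <- s) val (g q) = \sum_(q <- s) val (f q).
  apply: eq_big_seq => q qs; rewrite gf //.
  by apply: contraNneq ps => <-.
by rewrite -fy uE addrA addNr add0r.
Qed.

Definition pproj (p : nat) (x : A) : pcomponent A p :=
  sval (cid (primary_decomposition_exists x)) p.

Lemma primary_decomposition_widen (x : A) f (s r : seq nat) :
  uniq s -> uniq r -> {subset s <= r} ->
  (forall p, p \notin s -> f p = 0 :> pcomponent A p) ->
  x = \sum_(p <- s) val (f p) -> x = \sum_(p <- r) val (f p).
Proof.
move=> us ur sr f0 ->; rewrite [RHS](bigID (mem s)) /=.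
rewrite [X in _ + X]big1 ?addr0; last by move=> p /f0 ->.
rewrite -[RHS]big_filter; apply: perm_big; apply: uniq_perm => //.
  exact: filter_uniq.
by move=> p; rewrite mem_filter; case: (boolP (p \in s)) => // /sr ->.
Qed.

Lemma primary_decompositionB (x y : A) f g :
  primary_decomposition x f -> primary_decomposition y g ->
  primary_decomposition (x - y) (fun p => f p - g p).
Proof.
move=> [s [us ps f0 xE]] [t [ut pt g0 yE]]; exists (undup (s ++ t)).
split=> [||p|]; first exact: undup_uniq.
- by apply/allP => p; rewrite mem_undup mem_cat => /orP[/(allP ps)|/(allP pt)].
- by rewrite mem_undup mem_cat negb_or => /andP[/f0 -> /g0 ->]; rewrite subr0.
have sub1 : {subset s <= undup (s ++ t)}.
  by move=> p ps'; rewrite mem_undup mem_cat ps'.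
have sub2 : {subset t <= undup (s ++ t)}.
  by move=> p pt'; rewrite mem_undup mem_cat pt' orbT.
rewrite (primary_decomposition_widen us (undup_uniq _) sub1 f0 xE).
rewrite (primary_decomposition_widen ut (undup_uniq _) sub2 g0 yE).
by rewrite -sumrB; apply: eq_bigr => p _; rewrite raddfB.
Qed.

Lemma primary_decomposition0 f :
  primary_decomposition (0 : A) f -> forall p, f p = 0.
Proof.
move=> [s [us ps f0 sE]] p; have [pS|/f0 //] := boolP (p \in s).
have pp := allP ps _ pS.
have [M cM MK] : exists2 M, coprime p M & (\sum_(q <- rem p s) val (f q)) *+ M = 0.
  have : all (fun q => prime q && (q != p)) (rem p s).
    apply/allP => q; rewrite mem_rem_uniq // inE => /andP[-> qs].
    by rewrite (allP ps).
  elim: (rem p s) => [_|q t IH /= /andP[/andP[pq qp] /IH[M cM MK]]].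
    by exists 1%N; rewrite ?coprimen1 // big_nil.
  have /asboolP[n fq] := valP (f q).
  exists (q ^ n * M)%N.
    by rewrite coprimeMr cM andbT coprimeXr // prime_coprime // dvdn_prime2 // eq_sym.
  by rewrite big_cons mulrnDl mulrnA fq mul0rn add0r mulnC mulrnA MK mul0rn.
have fM : val (f p) *+ M = 0.
  move: sE; rewrite (perm_big _ (perm_to_rem pS)) big_cons => /esym/eqP.
  by rewrite addr_eq0 => /eqP ->; rewrite mulNrn MK oppr0.
have /asboolP[n fn] := valP (f p).
apply: val_inj; rewrite raddf0.
have pn0 : (0 < p ^ n)%N by rewrite expn_gt0 prime_gt0.
case: (egcdnP M pn0) => u v uv _; move: uv.
have /eqP -> : coprime (p ^ n) M by rewrite coprimeXl.
move=> /(congr1 (fun k => val (f p) *+ k)).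
by rewrite mulnC mulrnA fn mul0rn mulrnDr mulr1n mulnC mulrnA fM mul0rn add0r.
Qed.

Lemma primary_decomposition_uniq (x : A) f g :
  primary_decomposition x f -> primary_decomposition x g -> forall p, f p = g p.
Proof.
move=> fx gx p; apply/eqP; rewrite -subr_eq0; apply/eqP.
move: p; apply: primary_decomposition0.
by rewrite -[X in primary_decomposition X](subrr x); exact: primary_decompositionB.
Qed.

Fact pproj_is_zmod_morphism (p : nat) : zmod_morphism (pproj p).
Proof.
have dec x : primary_decomposition x (pproj ^~ x).
  by rewrite /pproj; case: cid.
move=> x y.
exact: (primary_decomposition_uniq (dec _) (primary_decompositionB (dec x) (dec y))).
Qed.

HB.instance Definition _ (p : nat) :=
  GRing.isZmodMorphism.Build A (pcomponent A p) (pproj p)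
    (pproj_is_zmod_morphism p).

End PrimaryProjection.

Section InducedCocycle.
Variables (Q : finGroupType) (A : zmodType) (torA : torsion A) (eps : Z2 Q A).
Variables (p : nat) (P : {group Q}).

Definition induced_fun (x y : [subg P]) : pcomponent A p :=
  pproj torA p (eps (sgval x) (sgval y)).

Fact induced_g1 g : induced_fun g 1%g = 0.
Proof. by rewrite /induced_fun cocycle_g1 raddf0. Qed.

Fact induced_1g g : induced_fun 1%g g = 0.
Proof. by rewrite /induced_fun cocycle_1g raddf0. Qed.

Fact inducedP h g k :
  induced_fun h g + induced_fun (h * g)%g k
    = induced_fun g k + induced_fun h (g * k)%g.
Proof. by rewrite /induced_fun -!raddfD /= cocycleP. Qed.

Definition induced_cocycle : Z2 (subg_of P) (pcomponent A p) :=
  Cocycle induced_g1 induced_1g inducedP.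

End InducedCocycle.

(* Main.v *)
From HB Require Import structures.
Require Import Defs.
From mathcomp Require Import all_boot all_fingroup all_algebra all_solvable.
From mathcomp Require Import boolp classical_sets.

Set Implicit Arguments.
Unset Strict Implicit.
Unset Printing Implicit Defensive.

Import GRing.Theory.

(** An isomorphism of perturbed products that preserves A is the same thing as
    a triple: an automorphism alpha of A, an automorphism beta of Q, and a
    1-cochain t : Q -> A whose coboundary is the difference between alpha
    applied to the first cocycle and the pullback of the second one along
    beta ([upper_isomorphic_coord], [upper_isomorphic_of_coord]).  So two
    automorphisms have to be built, and then a class has to vanish in
    H^2(Q, A).

    The automorphisms are assembled from the local ones.  A torsion group is
    the restricted direct product of its p-components and a finite nilpotent
    group the direct product of its Sylow subgroups, hence the local alpha_p
    and beta_p give a global alpha ([glue_components], the identity on the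
    components at primes not dividing |Q|) and a global beta ([glue_Sylow]).

    Let c be the 2-cocycle alpha o eps1 - beta^* eps2.  The local cochains say
    that the p-component of c is a coboundary on the Sylow p-subgroup, for every
    prime p dividing |Q|; they do not directly say anything about c on pairs of
    elements of different Sylow subgroups, nor about the components of c at
    the other primes.  Both gaps are closed by the transfer argument: a cocycle
    that is a coboundary on a subgroup P becomes a coboundary on Q after
    multiplication by the index |Q : P| ([transfer_coboundary]).  Since c takes
    finitely many values it is killed by some n > 0, and multiplying by the
    p'-part of n replaces c by a multiple of its p-component
    ([pproj_multiple]); so some multiple of c by an integer prime to p is a
    coboundary.  Moreover |Q| c is one, by transfer from the trivial subgroup.
    The integers k for which k c is a coboundary form an ideal, which contains
    |Q| and, for each prime p dividing |Q|, an integer prime to p: it contains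
    1 ([coboundary_of_primes]). *)

(** * Upper isomorphisms in coordinates *)

Section UpperIso.
Local Open Scope ring_scope.
Variables (Q : groupType) (A : zmodType).

Definition upper_datum (eps eps' : Q -> Q -> A)
    (alpha : A -> A) (beta : Q -> Q) (t : Q -> A) :=
  [/\ zmod_morphism alpha, bijective alpha,
      {morph beta : x y / (x * y)%g}, bijective beta
    & forall x y, alpha (eps x y) + t (x * y)%g
                    = t x + t y + eps' (beta x) (beta y)].

(** Every (a, x) is the product (a, 1)(0, x), so an upper isomorphism is
    determined by its values on A x {1}, which give alpha, and on {1} x Q, which
    give t and beta. *)
Lemma upper_isomorphic_coord (eps eps' : Z2 Q A) :
  upper_isomorphic eps eps' ->
  exists alpha beta t, upper_datum eps eps' alpha beta t.
Proof.
case=> phi [[psi phiK psiK] phi_base].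
have base2 a : (phi (a, 1%g)).2 = 1%g.
  have : pp_base eps' (phi (a, 1%g)) by rewrite -phi_base; exists (a, 1%g).
  by case.
(* The inverse of phi preserves A as well; this makes alpha surjective. *)
have psi_base2 b : (psi (b, 1%g)).2 = 1%g.
  have : (phi @` pp_base eps)%classic (b, 1%g) by rewrite phi_base.
  by case=> -[a x] [_ /= ->] <-; rewrite phiK.
have phiE a x : phi (a, x) = ((phi (a, 1%g)).1 + (phi (0, x)).1, (phi (0, x)).2).
  have -> : (a, x) = (((a, 1%g) : perturbed_prod eps) * (0, x))%g.
    by congr pair; rewrite /= ?cocycle_1g ?addr0 ?mul1g.
  rewrite gmulfM; congr pair => /=.
    by rewrite base2 cocycle_1g addr0.
  by rewrite base2 mul1g.
pose alpha a := (phi (a, 1%g)).1.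
have alphaD : {morph alpha : a b / a + b}.
  move=> a b; rewrite /alpha.
  have -> : (a + b, 1%g) = (((a, 1%g) : perturbed_prod eps) * (b, 1%g))%g.
    by congr pair; rewrite /= ?cocycle_1g ?addr0 ?mul1g.
  by rewrite gmulfM /= !base2 cocycle_1g addr0.
have bij_alpha : bijective alpha.
  exists (fun b => (psi (b, 1%g)).1) => [a|b]; rewrite /alpha.
    have -> : ((phi (a, 1%g)).1, 1%g) = phi (a, 1%g).
      by rewrite [RHS]surjective_pairing base2.
    by rewrite phiK.
  have -> : ((psi (b, 1%g)).1, 1%g) = psi (b, 1%g).
    by rewrite [RHS]surjective_pairing psi_base2.
  by rewrite psiK.
exists alpha, (fun x => (phi (0, x)).2), (fun x => (phi (0, x)).1); split=> //.
- move=> a b; apply: (addIr (alpha b)).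
  by rewrite -alphaD !subrK.
- move=> x y /=; transitivity (phi (((0, x) : perturbed_prod eps) * (0, y))%g).2.
    by rewrite [in RHS]phiE /= [in LHS]phiE.
  by rewrite gmulfM.
- have betaK y : (phi (0, (psi (0, y)).2)).2 = y.
    have := phiE (psi (0, y)).1 (psi (0, y)).2.
    by rewrite -surjective_pairing psiK => -[_ <-].
  have beta_inj : injective (fun x => (phi (0, x)).2).
    (* If (0, x) and (0, y) have images in the same coset of A, an element of A
       makes up for the difference of these images. *)
    move=> x y xy; case: bij_alpha => alpha' _ alphaK.
    have : phi (alpha' ((phi (0, y)).1 - (phi (0, x)).1), x) = phi (0, y).
      rewrite phiE -/(alpha _) alphaK subrK [RHS]surjective_pairing.
      by congr pair.
    by move/(can_inj phiK) => [_ ->].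
  by exists (fun y => (psi (0, y)).2) => // x; apply: beta_inj; rewrite betaK.
- move=> x y; rewrite -[RHS]/((phi (0, x) * phi (0, y))%g).1 -gmulfM.
  by rewrite [in RHS]phiE /= !add0r.
Qed.

Lemma upper_isomorphic_of_coord (eps eps' : Z2 Q A) alpha beta t :
  upper_datum eps eps' alpha beta t -> upper_isomorphic eps eps'.
Proof.
case=> alphaB [alpha' alphaK alphaK'] betaM [beta' betaK betaK'] E.
have alpha0 : alpha 0 = 0 by rewrite -[in LHS](subrr 0) alphaB subrr.
have alphaD a b : alpha (a + b) = alpha a + alpha b.
  by rewrite -[in LHS](opprK b) alphaB -[- b]sub0r alphaB alpha0 sub0r opprK.
have beta1 : beta 1%g = 1%g.
  by apply: (mulgI (beta 1%g)); rewrite -betaM !mulg1.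
have t1 : t 1%g = 0.
  apply: (addrI (t 1%g)); have := E 1%g 1%g.
  by rewrite beta1 !cocycle_1g mulg1 alpha0 add0r !addr0 => <-.
pose phi (u : perturbed_prod eps) : perturbed_prod eps' :=
  (alpha u.1 + t u.2, beta u.2).
have phiM : {morph phi : u v / (u * v)%g}.
  move=> [a x] [b y]; congr pair => /=; last exact: betaM.
  rewrite !alphaD -addrA E !addrA; congr (_ + _).
  by rewrite -!addrA; congr (_ + _); rewrite addrCA.
pose phi_mor := isMultiplicative.Build _ _ phi phiM.
pose Phi : {multiplicative perturbed_prod eps -> perturbed_prod eps'} :=
  HB.pack phi phi_mor.
exists Phi; split.
  exists (fun v => (alpha' (v.1 - t (beta' v.2)), beta' v.2)) => -[a x] /=.
    by rewrite /phi /= betaK addrK alphaK.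
  by rewrite /phi /= alphaK' subrK betaK'.
rewrite eqEsubset; split=> [_ [[a x] [_ /= ->] <-]|[b y] [_ /= ->]].
  by split=> //=; rewrite beta1.
exists (alpha' b, 1%g); first by [].
by rewrite /= /phi /= alphaK' t1 addr0 beta1.
Qed.
End UpperIso.

(** * Transfer for 2-cocycles *)

Section Transfer.
Local Open Scope ring_scope.
Variables (Q : finGroupType) (A : zmodType).
Implicit Types (c : Z2 Q A) (P : {group Q}).

(** The coboundary of t is written without subtraction; t ranges over functions
    on all of Q because only its values on P matter. *)
Definition coboundary_on (P : {set Q}) (c : Q -> Q -> A) :=
  exists t : Q -> A, {in P &, forall x y, c x y + t (x * y)%g = t x + t y}.

(** The cochain that trivializes c on P x P can be extended so that it
    trivializes c on P x Q: on a coset P r the extension is prescribed by its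
    value at r and by the cocycle identity for (p, q, r). *)
Lemma coboundary_extend c P : coboundary_on P c ->
  exists u : Q -> A, forall p x, p \in P -> c p x + u (p * x)%g = u p + u x.
Proof.
case=> t ct.
pose r x : Q := repr (P :* x)%g.
pose u x := t (x * (r x)^-1)%g - c (x * (r x)^-1)%g (r x).
(* The chosen representative of P itself is 1. *)
have uP p : p \in P -> u p = t p.
  move=> pP; rewrite /u /r rcoset_id // repr_group.
  by rewrite invg1 mulg1 cocycle_g1 subr0.
exists u => p x pP; rewrite (uP p) // /u.
have -> : r (p * x)%g = r x by rewrite /r rcosetM rcoset_id.
set q := (x * (r x)^-1)%g.
have qP : q \in P.
  by rewrite -mem_rcoset rcoset_sym /r mem_repr_rcoset.
rewrite -[(p * x * _)%g]mulgA -/q.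
have := cocycleP c p q (r x); rewrite mulgKV => cE.
apply: (addrI (c q (r x))); rewrite addrA -cE.
by rewrite addrACA subrr addr0 ct // [RHS]addrC [in RHS]addrA subrK.
Qed.

(** After subtracting the coboundary of the extended cochain, the cocycle
    vanishes on P x Q, so as a function of its first argument it is constant on
    right cosets of P.  Summing the cocycle identity over the |Q : P| cosets in
    that argument exhibits the multiple by |Q : P| as a coboundary. *)
Lemma transfer_coboundary c P : coboundary_on P c ->
  coboundary_on [set: Q] (fun x y => c x y *+ #|[set: Q] : P|%g).
Proof.
move=> /coboundary_extend[u cu].
have [d cd] : exists d : Q -> Q -> A,
    forall x y, c x y + u (x * y)%g = d x y + (u x + u y).
  by exists (fun x y => c x y + u (x * y)%g - (u x + u y)) => x y; rewrite subrK.
have dP p x : p \in P -> d p x = 0.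
  by move=> pP; apply: (addIr (u p + u x)); rewrite -cd cu // add0r.
have dC h g k : d h g + d (h * g)%g k = d g k + d h (g * k)%g.
  apply: (addIr (u h + u g + u k)).
  transitivity (c h g + c (h * g)%g k + u (h * g * k)%g).
    apply: (addIr (u (h * g)%g)); rewrite [RHS](ACl ((1*4)*(2*3))%AC) /= !cd.
    by rewrite !addrA [RHS](ACl (1*4*2*3*6*5)%AC).
  rewrite cocycleP -mulgA; apply: (addIr (u (g * k)%g)).
  rewrite [LHS](ACl ((1*4)*(2*3))%AC) /= !cd.
  by rewrite !addrA [LHS](ACl (1*4*5*2*3*6)%AC).
have d_coset p g k : p \in P -> d (p * g)%g k = d g k.
  by move=> pP; have := dC p g k; rewrite !(dP p) // add0r addr0.
pose m := #|[set: Q] : P|%g; rewrite -/m.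
pose s g := \sum_(C in rcosets P [set: Q]) d (repr C) g.
(* Right translation by g permutes the cosets, so the sum over C of d (C g) k
   is again s k. *)
have ds g k : s g + s k = d g k *+ m + s (g * k)%g.
  have -> : d g k *+ m = \sum_(C in rcosets P [set: Q]) d g k.
    by rewrite sumr_const.
  rewrite /s -[RHS]big_split /=; under [RHS]eq_bigr do rewrite -dC.
  rewrite [RHS]big_split /=; congr (_ + _).
  have cosetMr y C :
      C \in rcosets P [set: Q] -> (C :* y)%g \in rcosets P [set: Q].
    case/rcosetsP=> x _ ->; rewrite -rcosetM.
    by apply/rcosetsP; exists (x * y)%g.
  rewrite (reindex_astabs 'Rs%act g) /=; last first.
    apply/astabsP => C /=; rewrite rcosetE; apply/idP/idP; last exact: cosetMr.
    by move/(cosetMr g^-1%g); rewrite rcosetK.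
  apply: eq_bigr => C /rcosetsP[x _ ->{C}].
  rewrite rcosetE -rcosetM.
  case: repr_rcosetP => p pP; case: repr_rcosetP => q qP.
  by rewrite -mulgA (d_coset p) // (d_coset q).
exists (fun x => s x + u x *+ m) => x y _ _.
rewrite addrCA -mulrnDl cd mulrnDl addrA [s (x * y)%g + _]addrC -ds mulrnDl.
by rewrite addrACA.
Qed.

(** The multipliers turning c into a coboundary are the multiples of the least
    positive one, d.  It divides |Q|, by transfer from the trivial subgroup, so
    a prime factor of d would be a prime p dividing |Q| and every multiplier. *)
Lemma coboundary_of_primes c :
  (forall p, p \in primes #|Q| -> exists2 k, ~~ (p %| k)%N &
     coboundary_on [set: Q] (fun x y => c x y *+ k)) ->
  coboundary_on [set: Q] c.
Proof.
move=> cp.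
pose T k := coboundary_on [set: Q] (fun x y => c x y *+ k).
have TB a b : (b <= a)%N -> T a -> T b -> T (a - b)%N.
  move=> ba [s sE] [t tE]; exists (fun x => s x - t x) => x y xQ yQ.
  by rewrite mulrnBr // addrACA -opprD sE // tE // opprD addrACA.
have TM a b : T a -> T (a * b)%N.
  case=> s sE; exists (fun x => s x *+ b) => x y xQ yQ.
  by rewrite mulrnA -!mulrnDl sE.
have T0 : T #|Q|.
  have [|s sE] := @transfer_coboundary c 1%G.
    exists (fun=> 0) => x y /set1P -> /set1P ->.
    by rewrite cocycle_1g.
  by exists s => x y xQ yQ; rewrite -sE // indexg1 cardsT.
have ex : exists k, `[< (0 < k)%N /\ T k >].
  by exists #|Q|; apply/asboolP; split=> //; apply/card_gt0P; exists 1%g.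
case: (ex_minnP ex) => d /asboolP[d0 Td] dmin.
have dvdT k : T k -> (d %| k)%N.
  move=> Tk; apply: contraT; rewrite /dvdn -lt0n => rk.
  have : T (k %% d)%N.
    have -> : (k %% d = k - k %/ d * d)%N by rewrite {2}(divn_eq k d) addKn.
    by apply: TB; rewrite ?leq_divM // mulnC; apply: TM.
  move=> Tr; have := dmin _ (asboolT (conj rk Tr)).
  by rewrite leqNgt ltn_mod d0.
suff d1 : d = 1%N by move: Td; rewrite d1.
apply/eqP; rewrite eqn_leq d0 andbT leqNgt; apply/negP => d_gt1.
have pd : pdiv d \in primes #|Q|.
  rewrite mem_primes pdiv_prime // (dvdn_trans (pdiv_dvd d)) ?andbT ?dvdT //=.
  by apply/card_gt0P; exists 1%g.
have [k pd_k /dvdT d_k] := cp _ pd.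
by rewrite (dvdn_trans (pdiv_dvd d) d_k) in pd_k.
Qed.
End Transfer.

Section CocycleOperations.
Local Open Scope ring_scope.

Definition cocycle_mul (Q : groupType) (A : zmodType) (c : Z2 Q A) (n : nat) : Z2 Q A.
Proof.
apply: (@Cocycle Q A (fun x y => c x y *+ n)) => [g|g|h g k].
- by rewrite cocycle_g1 mul0rn.
- by rewrite cocycle_1g mul0rn.
- by rewrite -!mulrnDl cocycleP.
Defined.

(** The cocycle whose triviality is equivalent to the existence of an upper
    isomorphism inducing alpha on A and beta on Q. *)
Lemma cocycle_defect (Q : groupType) (A : zmodType) (eps eps' : Z2 Q A)
    (alpha : A -> A) (beta : Q -> Q) :
  zmod_morphism alpha -> {morph beta : x y / (x * y)%g} ->
  exists c : Z2 Q A,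
    forall x y, c x y = alpha (eps x y) - eps' (beta x) (beta y).
Proof.
move=> alphaB betaM.
pose alpha_mor := GRing.isZmodMorphism.Build A A alpha alphaB.
pose f : {additive A -> A} := HB.pack alpha alpha_mor.
have alpha0 : alpha 0 = 0 := raddf0 f.
have alphaD : {morph alpha : a b / a + b} := raddfD f.
have beta1 : beta 1%g = 1%g.
  by apply: (mulgI (beta 1%g)); rewrite -betaM !mulg1.
unshelve eexists (@Cocycle Q A (fun x y => alpha (eps x y) - eps' (beta x) (beta y)) _ _ _).
- by move=> g /=; rewrite cocycle_g1 beta1 cocycle_g1 subr0 alpha0.
- by move=> g /=; rewrite cocycle_1g beta1 cocycle_1g subr0 alpha0.
- move=> h g k /=; rewrite !betaM addrACA -opprD -alphaD !cocycleP.
  by rewrite alphaD opprD addrACA.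
by [].
Qed.

Lemma cocycle_exponent (Q : finGroupType) (A : zmodType) (c : Z2 Q A) :
  torsion A -> exists2 n, (0 < n)%N & forall x y, c x y *+ n = 0.
Proof.
move=> torA.
pose e (u : Q * Q) := sval (cid2 (torA (c u.1 u.2))).
have eP u : (0 < e u)%N /\ c u.1 u.2 *+ e u = 0 by rewrite /e; case: cid2.
exists (\prod_u e u)%N => [|x y].
  by apply: prodn_gt0 => u; case: (eP u).
by rewrite (bigD1 (x, y)) //= mulrnA (proj2 (eP (x, y))) mul0rn.
Qed.
End CocycleOperations.

(** * Primary components of a torsion group *)

Section Primary.
Local Open Scope ring_scope.
Variables (A : zmodType) (torA : torsion A).
Local Notation pi := (pproj torA).

Lemma mulrn_coprime_eq0 (V : zmodType) (x : V) a b :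
  coprime a b -> x *+ a = 0 -> x *+ b = 0 -> x = 0.
Proof.
move=> cop xa xb; have [a0|a_gt0] := posnP a.
  by move: cop xb; rewrite a0 /coprime gcd0n => /eqP->.
case: (egcdnP b a_gt0) => u v uv _; move: (congr1 (GRing.natmul x) uv).
by rewrite (eqP cop) mulnC mulrnA xa mul0rn mulrnDr mulnC mulrnA xb mul0rn add0r.
Qed.

Lemma pcomponent_order p (a : pcomponent A p) : exists n, a *+ (p ^ n) = 0.
Proof.
by have /asboolP[n an] := valP a; exists n; apply: val_inj; rewrite raddfMn.
Qed.

Lemma pprojP (x : A) : primary_decomposition x (pi ^~ x).
Proof. by rewrite /pproj; case: cid. Qed.

Lemma eq_from_pproj (x y : A) : (forall p, pi p x = pi p y) -> x = y.
Proof.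
move=> xy; apply/eqP; rewrite -subr_eq0; apply/eqP.
have [s [_ _ _ ->]] := pprojP (x - y).
by rewrite big1 // => p _; rewrite !raddfB /= xy subrr.
Qed.

Lemma pproj_val_neq p q (a : pcomponent A p) :
  prime p -> q != p -> pi q (val a) = 0.
Proof.
move=> p_pr qp; have [s [_ s_pr s0 _]] := pprojP (val a).
have [q_s|/s0 //] := boolP (q \in s); have q_pr := allP s_pr _ q_s.
have [n an] := pcomponent_order a; have [m bm] := pcomponent_order (pi q (val a)).
apply: (@mulrn_coprime_eq0 _ _ (p ^ n) (q ^ m)) => //.
  by rewrite coprimeXl // coprimeXr // prime_coprime // dvdn_prime2 // eq_sym.
by rewrite -raddfMn -raddfMn an !raddf0.
Qed.

Lemma pproj_val p (a : pcomponent A p) : prime p -> pi p (val a) = a.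
Proof.
move=> p_pr; apply: val_inj; have [s [s_uniq s_pr s0 aE]] := pprojP (val a).
have aE' : val a = \sum_(q <- s | q == p) val (pi q (val a)).
  rewrite {1}aE (bigID (pred1 p)) /= [X in _ + X]big1 ?addr0 // => q qp.
  by rewrite pproj_val_neq // raddf0.
have [p_s|p_s] := boolP (p \in s).
  by rewrite [RHS]aE' -big_filter filter_pred1_uniq // big_seq1.
rewrite s0 // raddf0 [RHS]aE' big1_seq // => q /andP[/eqP-> q_s].
by rewrite q_s in p_s.
Qed.

(** On the components at the primes of s this is the direct product of the
    alpha p.  Correcting x, rather than summing over all primes, leaves the
    other components unchanged while only a finite sum occurs. *)
Definition glue_components (s : seq nat)
    (alpha : forall p, pcomponent A p -> pcomponent A p) (x : A) : A :=
  x + \sum_(p <- s) val (alpha p (pi p x) - pi p x).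

Lemma pproj_glue_components s alpha x q : uniq s -> all prime s ->
  pi q (glue_components s alpha x) = if q \in s then alpha q (pi q x) else pi q x.
Proof.
move=> s_uniq s_pr.
have -> : pi q (glue_components s alpha x) =
    pi q x + \sum_(p <- s) pi q (val (alpha p (pi p x) - pi p x)).
  by rewrite raddfD raddf_sum.
have rest p : p \in s -> p != q -> pi q (val (alpha p (pi p x) - pi p x)) = 0.
  by move=> p_s pq; rewrite pproj_val_neq ?(allP s_pr) // eq_sym.
case: ifP => q_s.
  rewrite (bigD1_seq q) // pproj_val ?(allP s_pr) //.
  rewrite big1_seq /= ?addr0 ?subrKC //.
  by move=> p /andP[pq p_s]; apply: rest.
rewrite big1_seq ?addr0 // => p p_s; apply: rest => //.
by apply: contraTneq p_s => ->; rewrite q_s.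
Qed.

Lemma glue_components_zmod_morphism s alpha : uniq s -> all prime s ->
  (forall p, zmod_morphism (alpha p)) -> zmod_morphism (glue_components s alpha).
Proof.
move=> s_uniq s_pr alphaB x y; apply: eq_from_pproj => q.
rewrite raddfB /= !pproj_glue_components // raddfB /=.
by case: ifP => // _; apply: alphaB.
Qed.

Lemma glue_components_bij s alpha : uniq s -> all prime s ->
  (forall p, bijective (alpha p)) -> bijective (glue_components s alpha).
Proof.
move=> s_uniq s_pr alpha_bij.
have inv p : exists g, cancel (alpha p) g /\ cancel g (alpha p).
  by case: (alpha_bij p) => g; exists g.
pose alpha' p := sval (cid (inv p)).
have alphaK p : cancel (alpha p) (alpha' p) := proj1 (svalP (cid (inv p))).
have alphaK' p : cancel (alpha' p) (alpha p) := proj2 (svalP (cid (inv p))).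
exists (glue_components s alpha') => x; apply: eq_from_pproj => q.
  by rewrite !pproj_glue_components //; case: (q \in s); rewrite ?alphaK.
by rewrite !pproj_glue_components //; case: (q \in s); rewrite ?alphaK'.
Qed.

(** Multiplying by the p'-part of n kills the components of x at primes other
    than p, since their orders are p'-numbers dividing n. *)
Lemma pproj_multiple p n (x : A) : prime p -> (0 < n)%N -> x *+ n = 0 ->
  x *+ n`_p^' = val (pi p x) *+ n`_p^'.
Proof.
move=> p_pr n_gt0 xn; apply: eq_from_pproj => q; rewrite !raddfMn /=.
have [->|qp] := eqVneq q p; first by rewrite pproj_val.
rewrite pproj_val_neq // mul0rn.
have [s [_ s_pr s0 _]] := pprojP x.
have [q_s|/s0 ->] := boolP (q \in s); last by rewrite mul0rn.
have q_pr := allP s_pr _ q_s.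
have [m xm] := pcomponent_order (pi q x).
apply: (@mulrn_coprime_eq0 _ _ n`_p (q ^ m)).
- by rewrite coprimeXr // (@pnat_coprime p) ?part_pnat // !pnatE //= /= inE /= eq_sym.
- by rewrite -mulrnA mulnC partnC // -raddfMn xn raddf0.
- by rewrite mulrnAC xm mul0rn.
Qed.
End Primary.

(** * Sylow components of a finite nilpotent group *)

Section Nilpotent.
Local Open Scope group_scope.
Variable Q : finGroupType.
Hypothesis nilQ : nilpotent [set: Q].

(** In a nilpotent group the pi-elements form a subgroup that centralizes the
    subgroup of the pi'-elements, so taking pi-constituents is a morphism: it
    is the projection of the group onto a direct factor. *)
Lemma consttM_nil (pi : nat_pred) (x y : Q) : (x * y).`_pi = x.`_pi * y.`_pi.
Proof.
have mem (rho : nat_pred) z : z.`_rho \in 'O_rho([set: Q]).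
  by rewrite (mem_Hall_pcore (nilpotent_pcore_Hall rho nilQ)) ?p_elt_constt ?inE.
have [_ _ cent _] := dprodP (nilpotent_pcoreC pi nilQ).
have comm (z u : Q) : commute z.`_pi u.`_pi^'.
  exact: commute_sym (centsP cent _ (mem _ _) _ (mem _ _)).
have xyE : x * y = x.`_pi * y.`_pi * (x.`_pi^' * y.`_pi^').
  rewrite -[in LHS](consttC pi x) -[in LHS](consttC pi y).
  by rewrite mulgA -(mulgA x.`_pi) -(comm y x) !mulgA.
rewrite [in LHS]xyE consttM; last first.
  by apply: commuteM; apply: commute_sym; apply: commuteM;
     apply: commute_sym; apply: comm.
have elt1 : pi.-elt (x.`_pi * y.`_pi).
  apply: mem_p_elt (pcore_pgroup pi [set: Q]) _.
  by rewrite groupM ?mem.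
have elt2 : pi^'.-elt (x.`_pi^' * y.`_pi^').
  apply: mem_p_elt (pcore_pgroup pi^' [set: Q]) _.
  by rewrite groupM ?mem.
by rewrite (constt_p_elt elt1) (constt1P elt2) mulg1.
Qed.

Lemma eq_from_constt (x y : Q) :
  (forall p : nat, p \in primes #|Q| -> x.`_p = y.`_p) -> x = y.
Proof.
move=> xy; have all_p (p : nat) : x.`_p = y.`_p.
  have [/xy //|pQ] := boolP (p \in primes #|Q|).
  have triv (z : Q) : z.`_p = 1.
    apply/constt1P; apply: (@mem_p_elt _ _ _ [set: Q]%G); last by rewrite inE.
    rewrite /pgroup cardsT; have [p_pr|p_npr] := boolP (prime p).
      rewrite p'natE //; apply: contra pQ => dvd; rewrite mem_primes p_pr dvd.
      by rewrite andbT; apply/card_gt0P; exists 1.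
    apply/pnatP => [|q q_pr _]; first by apply/card_gt0P; exists 1.
    by rewrite !inE; apply: contraNneq p_npr => <-.
  by rewrite !triv.
rewrite -[LHS]mulg1 -(mulVg y) mulgA; suff -> : x * y^-1 = 1 by rewrite mul1g.
rewrite -(prod_constt (x * y^-1)) big1 // => p _.
by apply: (mulIg y.`_p); rewrite mul1g -consttM_nil mulgKV.
Qed.

Variable Syl : nat -> {group Q}.
Hypothesis SylP : forall p, p \in primes #|Q| -> p.-Sylow([set: Q]) (Syl p).
Variable b : forall p, subg_of (Syl p) -> subg_of (Syl p).
Arguments b : clear implicits.
Hypothesis bM : forall p, {morph b p : x y / x * y}.
Hypothesis b_inj : forall p, injective (b p).

Lemma constt_Syl (p : nat) (x : Q) : p \in primes #|Q| -> x.`_p \in Syl p.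
Proof.
move=> pQ; rewrite (nilpotent_Hall_pcore nilQ (SylP pQ)).
by rewrite (mem_Hall_pcore (nilpotent_pcore_Hall p nilQ)) ?p_elt_constt ?inE.
Qed.

Definition glue_Sylow (x : Q) : Q :=
  \prod_(p <- primes #|Q|) sgval (b p (subg (Syl p) x.`_p)).

Lemma Syl_elt p (z : subg_of (Syl p)) : p \in primes #|Q| -> p.-elt (sgval z).
Proof.
by move=> pQ; apply: mem_p_elt (subgP z); apply: pHall_pgroup (SylP pQ).
Qed.

Lemma constt_subg p q (z : subg_of (Syl p)) :
  p \in primes #|Q| -> q \in primes #|Q| ->
  (sgval z).`_q = if p == q then sgval z else 1.
Proof.
move=> pQ qQ; case: eqVneq => [<-|pq]; first exact/constt_p_elt/Syl_elt.
apply/constt1P; apply: sub_p_elt (Syl_elt z pQ) => r; rewrite !inE => /eqP->.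
exact: pq.
Qed.

Lemma constt_glue_Sylow (q : nat) (x : Q) : q \in primes #|Q| ->
  (glue_Sylow x).`_q = sgval (b q (subg (Syl q) x.`_q)).
Proof.
move=> qQ.
rewrite /glue_Sylow.
rewrite (big_morph (fun z : Q => z.`_q) (consttM_nil q) (constt1 Q q)).
rewrite (eq_big_seq (fun p =>
    if p == q then sgval (b q (subg (Syl q) x.`_q)) else 1)).
  by rewrite -big_mkcond -big_filter filter_pred1_uniq ?primes_uniq // big_seq1.
by move=> p pQ; rewrite constt_subg //; case: eqVneq => [->|//].
Qed.

Lemma glue_SylowM : {morph glue_Sylow : x y / x * y}.
Proof.
move=> x y; apply: eq_from_constt => q qQ.
rewrite consttM_nil !constt_glue_Sylow // consttM_nil subgM ?constt_Syl //.
by rewrite bM.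
Qed.

Lemma glue_Sylow_inj : injective glue_Sylow.
Proof.
move=> x y xy; apply: eq_from_constt => q qQ.
have := constt_glue_Sylow x qQ; rewrite xy constt_glue_Sylow //.
move/val_inj/b_inj/(congr1 sgval).
by rewrite !subgK ?constt_Syl.
Qed.

Lemma glue_Sylow_val p (x : subg_of (Syl p)) : p \in primes #|Q| ->
  glue_Sylow (sgval x) = sgval (b p x).
Proof.
move=> pQ; apply: eq_from_constt => q qQ; rewrite constt_glue_Sylow //.
rewrite !constt_subg //; case: eqVneq => [<-|pq]; first by rewrite sgvalK.
have -> : subg (Syl q) 1 = 1 by apply: val_inj; rewrite /= subgK ?group1.
suff -> : b q 1 = 1 by [].
by apply: (mulIg (b q 1)); rewrite -bM !mul1g.
Qed.
End Nilpotent.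

(** * Upper isomorphisms over a nilpotent group *)

Theorem proposition4p5 (G1 : zmodType) (G2 : finGroupType) (torG1 : torsion G1)
    (eps1 eps2 : Z2 G2 G1) (Syl : nat -> {group G2}) :
  nilpotent [set: G2] ->
  (forall p, p \in primes #|G2| -> p.-Sylow([set: G2]) (Syl p))%g ->
  (forall p, p \in primes #|G2| ->
     upper_isomorphic (induced_cocycle torG1 eps1 p (Syl p))
                      (induced_cocycle torG1 eps2 p (Syl p))) ->
  upper_isomorphic eps1 eps2.
Proof.
move=> nilG SylP iso.
have pr_uniq := primes_uniq #|G2|.
have pr_prime : all prime (primes #|G2|).
  by apply/allP => p; rewrite mem_primes => /andP[].
(* At an index that is not a prime divisor of |G2| the default is the identity;
   this makes the local data a total family, from which one can choose. *)
have local_datum p : exists d : (pcomponent G1 p -> pcomponent G1 p) *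
      (subg_of (Syl p) -> subg_of (Syl p)) *
      (subg_of (Syl p) -> pcomponent G1 p),
    [/\ zmod_morphism d.1.1, bijective d.1.1, {morph d.1.2 : x y / (x * y)%g},
        bijective d.1.2
      & p \in primes #|G2| ->
        upper_datum (induced_cocycle torG1 eps1 p (Syl p))
                    (induced_cocycle torG1 eps2 p (Syl p)) d.1.1 d.1.2 d.2].
  have [/iso/upper_isomorphic_coord[a [b [t abt]]]|pG] :=
    boolP (p \in primes #|G2|).
    by exists (a, b, t); case: (abt).
  exists (id, id, fun=> 0%R); split=> //; exact: inv_bij.
pose d p := sval (cid (local_datum p)).
have dP p := svalP (cid (local_datum p)).
pose a p := (d p).1.1; pose b p := (d p).1.2; pose t p := (d p).2.
have bM p : {morph b p : x y / (x * y)%g} by case: (dP p).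
have b_inj p : injective (b p) by case: (dP p) => _ _ _ /bij_inj.
pose alpha := glue_components torG1 (primes #|G2|) a.
pose beta := glue_Sylow b.
have alphaB : zmod_morphism alpha.
  by apply: glue_components_zmod_morphism => // p; case: (dP p).
have alpha_bij : bijective alpha.
  by apply: glue_components_bij => // p; case: (dP p).
have betaM : {morph beta : x y / (x * y)%g} := glue_SylowM nilG SylP bM.
have beta_bij : bijective beta := injF_bij (glue_Sylow_inj nilG SylP b_inj).
have [c cE] := cocycle_defect eps1 eps2 alphaB betaM.
suff [s sE] : coboundary_on [set: G2] c.
  apply: (@upper_isomorphic_of_coord _ _ _ _ alpha beta s); split=> // x y.
  by rewrite -sE ?inE // cE [RHS]addrAC subrK.
have [n n_gt0 cn] := cocycle_exponent c torG1.
apply: coboundary_of_primes => p pG; have p_pr := allP pr_prime p pG.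
(* The p'-part of n reduces c to its p-component, and the index of the Sylow
   subgroup carries the local cochain over to the whole group. *)
exists (n`_p^' * #|[set: G2] : Syl p|%g)%N.
  by rewrite -p'natE // pnatM part_pnat; case/and3P: (SylP p pG).
suff : coboundary_on (Syl p) (cocycle_mul c n`_p^').
  by case/transfer_coboundary=> s sE; exists s => x y xG yG; rewrite mulrnA -sE.
exists (fun x => \val (t p (subg (Syl p) x)) *+ n`_p^')%R => x y xP yP /=.
rewrite (pproj_multiple torG1 p_pr n_gt0 (cn x y)) -!mulrnDl; congr (_ *+ _)%R.
have [_ _ _ _ /(_ pG)[_ _ _ _]] := dP p.
move/(_ (subg (Syl p) x) (subg (Syl p) y)).
rewrite -subgM // /= /induced_fun !subgK // -/(a p) -/(b p) -/(t p) => E.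
have betaE z : z \in Syl p -> sgval (b p (subg (Syl p) z)) = beta z.
  by move=> zP; rewrite -(glue_Sylow_val nilG SylP bM) // subgK.
rewrite !betaE // in E.
suff /(congr1 val) : (pproj torG1 p (c x y) + t p (subg (Syl p) (x * y))
    = t p (subg (Syl p) x) + t p (subg (Syl p) y))%R by [].
by rewrite cE raddfB /= pproj_glue_components // pG addrAC E addrK.
Qed.
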